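(* Let $g\ge1$ and $\kappa\ge1$ be integers, let $H$ be a graph, and let $A,B,X$ be disjoint subsets of $V(H)$ of cardinality $\kappa$ each, such that every vertex of $X$ has degree $1$ in $H$. Let $\mathcal{P}$ be a set of $\kappa$ node-disjoint paths connecting every vertex of $A$ to a distinct vertex of $B$, and $\mathcal{Q}$ a set of $\kappa$ node-disjoint paths connecting every vertex of $A$ to a distinct vertex of $X$, chosen among all such pairs $(\mathcal P,\mathcal Q)$ so as to minimize the number of edges of the graph $\bigcup_{P\in\mathcal P\cup\mathcal Q}P$ (assume at least one such pair exists). Let $D$ be any integer with $1\leq D\leq \kappa/(2g^2)$. Then either $H$ contains an $(A,B,X)$-crossbar of width $g^2$, or $H$ contains a pseudo-grid of depth $D$ with respect to $(\mathcal P,\mathcal Q)$.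
   Context: For $P\in\mathcal P$, $Q_P$ denotes the path of $\mathcal Q$ with the same endpoint in $A$ as $P$. A pseudo-grid of depth $D$ (with respect to $(\mathcal P,\mathcal Q)$) consists of: a family $\{\mathcal R_1,\ldots,\mathcal R_D\}$ of pairwise disjoint subsets of $\mathcal P$ with $|\mathcal R_i|\le g^2$ for all $i$; and, writing $\mathcal R=\bigcup_i\mathcal R_i$ and $\mathcal P'=\mathcal P\setminus\mathcal R$, a set $\mathcal Q'$ of $\lceil\kappa/4\rceil$ pairwise vertex-disjoint paths, each a sub-path of a distinct path of $\{Q_P\mid P\in\mathcal P'\}$ and having exactly one endpoint in $X$; such that (P1) the paths of $\mathcal P'$ are vertex-disjoint from the paths of $\mathcal Q'$, and (P2) for every $1\le i\le D$, at most $2g^2$ paths $Q\in\mathcal Q'$ are disjoint from all paths of $\mathcal R_i$. An $(A,B,X)$-crossbar of width $\rho$ consists of $\rho$ pairwise vertex-disjoint paths $\mathcal P^*$ each connecting a vertex of $A$ to a vertex of $B$, and for each $P\in\mathcal P^*$ a path $Q_P^*$ from a vertex of $P$ to a vertex of $X$, these paths pairwise vertex-disjoint, with $P\cap Q^*_{P'}=\emptyset$ for $P\ne P'$ and $P\cap Q^*_P$ a single vertex that is an endpoint of $Q^*_P$. *)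

(* Defs.v *)
From HB Require Import structures.
From mathcomp Require Import all_boot finmap.
Set Implicit Arguments.
Unset Strict Implicit.
Unset Printing Implicit Defensive.

(* A finite simple graph is a symmetric irreflexive relation [e] on a finite
   type [T].  A path is the duplicate-free sequence of its vertices; a path
   joining S1 to S2 is stored oriented from S1 to S2, which for disjoint S1 and
   S2 makes the sequence unique. *)

Definition is_path (T : finType) (e : rel T) (p : seq T) : bool :=
  if p is x :: s then path e x s && uniq (x :: s) else false.

(* A one-vertex path lists its vertex twice; thus it never has exactly one end
   in a given set. *)
Definition ends (T : finType) (p : seq T) : seq T :=
  if p is x :: s then [:: x; last x s] else [::].

Definition path_between (T : finType) (e : rel T) (S1 S2 : {pred T})
    (p : seq T) : bool :=
  is_path e p &&
  (if p is x :: s then (x \in S1) && (last x s \in S2) else false).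

Definition vdisjoint (T : finType) (F : {fset seq T}) : Prop :=
  forall p q : seq T, p \in F -> q \in F -> p != q -> [disjoint p & q].

(* The ends in S2 are automatically distinct, by vertex-disjointness. *)
Definition linkage (T : finType) (e : rel T) (S1 S2 : {set T})
    (F : {fset seq T}) : Prop :=
  [/\ #|` F| = #|S1|,
      forall p : seq T, p \in F -> path_between e S1 S2 p,
      vdisjoint F
    & forall a, a \in S1 -> exists2 p, p \in F & ohead p = Some a].

Definition path_edges (T : finType) (p : seq T) : {set {set T}} :=
  [set [set u.1; u.2] | u in zip p (behead p)]%SET.

Definition union_edges (T : finType) (F : {fset seq T}) : {set {set T}} :=
  (\bigcup_(p <- enum_fset F) path_edges p)%SET.

Definition min_linkages (T : finType) (e : rel T) (A B X : {set T})
    (P Q : {fset seq T}) : Prop :=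
  [/\ linkage e A B P, linkage e A X Q
    & forall P1 Q1, linkage e A B P1 -> linkage e A X Q1 ->
        #|union_edges (P `|` Q)%fset| <= #|union_edges (P1 `|` Q1)%fset|].

(* The path Q_P.  The endpoint in A of a path of a linkage from A is its first
   vertex; the default [::] is never reached for linkages with the same A. *)
Definition companion (T : finType) (Q : {fset seq T}) (p : seq T) : seq T :=
  head [::] [seq q <- enum_fset Q | ohead q == ohead p].

(* A sub-path is stored with the orientation of the path containing it.  The
   map [f] sends each path of Q' to the path of {Q_P | P in P'} it is taken
   from; (kappa + 3) %/ 4 is the ceiling of kappa / 4. *)
Definition has_pseudo_grid (T : finType) (X : {set T})
    (P Q : {fset seq T}) (g kappa D : nat) : Prop :=
  exists (R : 'I_D -> {fset seq T}) (Q' : {fset seq T}) (f : seq T -> seq T),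
    let P' := (P `\` \bigcup_(i in 'I_D) R i)%fset in
    [/\ [/\ forall i, (R i `<=` P)%fset,
            forall i j, i != j -> [disjoint R i & R j]%fset
          & forall i, #|` R i| <= g ^ 2],
        [/\ #|` Q'| = (kappa + 3) %/ 4,
            vdisjoint Q',
            {in Q' &, injective f}
          & forall q : seq T, q \in Q' ->
              [/\ f q \in [fset companion Q p | p in P']%fset, infix q (f q)
                & count [in X] (ends q) = 1]],
        forall p q : seq T, p \in P' -> q \in Q' -> [disjoint p & q]
      & forall i : 'I_D,
          #|` [fset q in Q' | all (fun p : seq T => [disjoint p & q])
                                  (enum_fset (R i))]%fset|
            <= 2 * g ^ 2].

Definition has_crossbar (T : finType) (e : rel T) (A B X : {set T})
    (rho : nat) : Prop :=
  exists (Ps : {fset seq T}) (Qs : seq T -> seq T),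
    [/\ #|` Ps| = rho,
        vdisjoint Ps,
        forall p : seq T, p \in Ps ->
          [/\ path_between e A B p, path_between e [in p] X (Qs p)
            & exists2 v, v \in ends (Qs p) &
                forall u, (u \in p) && (u \in Qs p) = (u == v)]
      & forall p p' : seq T, p \in Ps -> p' \in Ps -> p != p' ->
          [disjoint Qs p & Qs p'] /\ [disjoint p & Qs p']].

(* Main.v *)
Require Import Defs.
From mathcomp Require Import all_boot finmap zify.
From Stdlib Require Import Classical.

(** Index the paths of both linkages by their first vertex in [A], as [p a] and
    [q a].  For [S] a subset of [A], contract each [p a] with [a] in [S] to a
    vertex and apply Menger's theorem between these vertices and [X]: either
    [g ^ 2] disjoint paths exist, which gives a crossbar, or some [R] inside [S]
    and some set [Y] of other vertices, with
    [#|R| + #|Y| < g ^ 2], meet every path from the paths of [S :\: R] to [X].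
    Starting from [S = A] and replacing [S] by [S :\: R], this is done [D] times.
    For [a] in the last [S], the part of [q a] after its last vertex on a path
    of [S] meets, for each of the [D] cuts, a path of [R] or a vertex of [Y].
    As these parts are disjoint, fewer than [g ^ 2] of them avoid the paths of a
    given [R].  A part reduced to one vertex, necessarily in [X], can only meet
    the last [Y]; discarding those leaves at least [kappa - D (g ^ 2 - 1)]
    parts. *)

Set Implicit Arguments.
Unset Strict Implicit.
Unset Printing Implicit Defensive.

(** * Splitting a sequence at its first or last element with a given property *)

Lemma first_split (T : Type) (a : pred T) (p : seq T) :
  has a p -> exists p0 z s, [/\ p = p0 ++ z :: s, a z & ~~ has a p0].
Proof.
elim: p => //= x p IHp; have [ax _|nax /IHp] /= := boolP (a x).
  by exists [::], x, p.
case=> p0 [z [s [-> az nap]]].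
by exists (x :: p0), z, s; rewrite /= negb_or nax.
Qed.

Lemma last_split (T : Type) (a : pred T) (p : seq T) :
  has a p -> exists p0 z s, [/\ p = p0 ++ z :: s, a z & ~~ has a s].
Proof.
rewrite -has_rev => /first_split[p0 [z [s [def_p az nap]]]].
exists (rev s), z, (rev p0); rewrite has_rev; split=> //.
by rewrite -[p]revK def_p rev_cat rev_cons cat_rcons.
Qed.

Lemma disjoint_seqP (T : finType) (p q : seq T) :
  reflect (forall x, x \in p -> x \in q -> False) [disjoint p & q].
Proof.
rewrite disjoint_has; apply: (iffP hasPn) => [pq x xp xq | pq x xp].
  by have := pq x xp; rewrite /= xq.
by apply/negP=> /(pq x xp).
Qed.

(** * Menger's theorem for digraphs *)

Section Menger.

Variable T : finType.
Implicit Types (r : rel T) (A B S : {set T}) (p : seq T).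

(** Vertices may repeat within a walk: only disjointness of different walks matters here, and
    repetitions are removed when a crossbar is built. *)
Definition walk r A B p : bool :=
  if p is x :: s then [&& x \in A, path r x s & last x s \in B] else false.

Definition separates r A B S : Prop :=
  forall p, walk r A B p -> has [in S] p.

Definition disjoint_walks r A B k : Prop :=
  exists f : 'I_k -> seq T,
    (forall i, walk r A B (f i)) /\ (forall i j, i != j -> [disjoint f i & f j]).

Lemma walk_cat r A B p z s :
  walk r A B (p ++ z :: s) =
  walk r A [set z] (rcons p z) && walk r [set z] B (z :: s).
Proof.
case: p => [|x p] /=; first by rewrite !set11 /= andbT.
by rewrite last_rcons !set11 cat_path rcons_path last_cat /= !andbT -!andbA.
Qed.

Definition del_edge r x y : rel T :=
  fun u v => r u v && ((u, v) != (x, y)).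

Lemma del_edge_path_start r x y a s :
  path r a s -> x \notin belast a s -> path (del_edge r x y) a s.
Proof.
elim: s a => //= b s IHs a /andP[rab rbs]; rewrite inE negb_or => /andP[xa xs].
by rewrite {1}/del_edge rab xpair_eqE eq_sym (negPf xa) IHs.
Qed.

Lemma del_edge_path_end r x y a s :
  path r a s -> y \notin s -> path (del_edge r x y) a s.
Proof.
elim: s a => //= b s IHs a /andP[rab rbs]; rewrite inE negb_or => /andP[xa xs].
by rewrite {1}/del_edge rab xpair_eqE [b == y]eq_sym (negPf xa) andbF IHs.
Qed.

Lemma del_edge_walk r x y A B p :
  walk (del_edge r x y) A B p -> walk r A B p.
Proof.
case: p => //= a s /and3P[-> pa ->]; rewrite andbT /=.
by apply: sub_path pa => u v /andP[].
Qed.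

(** A walk that avoids [x] or avoids [y] does not use the arc [xy], so it survives the deletion and
    meets [S]. *)
Lemma separates_del_edge r x y A B S :
  separates (del_edge r x y) A B S ->
  (forall p, walk r A B p -> has [in x |: S] p) /\
  (forall p, walk r A B p -> has [in y |: S] p).
Proof.
have has1 z p : has [in z |: S] p = (z \in p) || has [in S] p.
  elim: p => //= u p ->; rewrite !inE [z == u]eq_sym; case: (u == z) => //=.
  by rewrite orbCA.
move=> sepS; split=> -[//|a s] wp; rewrite has1; case: (boolP (_ \in _)) => //= xs;
  apply: (sepS (a :: s)); case/and3P: wp => /= aA pa lB; rewrite aA lB andbT /=.
- by apply: del_edge_path_start => //; apply: contra xs => /mem_belast.
- by apply: del_edge_path_end => //; apply: contra xs; rewrite inE orbC => ->.
Qed.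

(** Up to its first vertex in [x |: S], a walk cannot have left [x], so this part does not use the
    arc [xy] and meets [Z]. *)
Lemma separates_start r x y A B S Z :
  separates r A B (x |: S) ->
  separates (del_edge r x y) A (x |: S) Z -> separates r A B Z.
Proof.
move=> sepS sepZ p wp; have /first_split[p0 [z [s [def_p zS p0S]]]] := sepS p wp.
move: wp; rewrite def_p walk_cat => /andP[wp _].
suffices: has [in Z] (rcons p0 z) by rewrite -cat_rcons has_cat => ->.
apply: sepZ; move: p0S wp; case: p0 {def_p} => [|a p0] /=.
  by rewrite zS => _ /andP[-> _].
rewrite last_rcons zS => p0S /and3P[-> pa _]; rewrite andbT /=.
apply: del_edge_path_start => //; rewrite belast_rcons.
apply/negP=> xp; case/negP: p0S; apply/(@hasP _ _ (a :: p0)); exists x => //=.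
exact: setU11.
Qed.

(** Mirror image: after its last vertex in [y |: S], a walk cannot enter [y]. *)
Lemma separates_end r x y A B S Z :
  separates r A B (y |: S) ->
  separates (del_edge r x y) (y |: S) B Z -> separates r A B Z.
Proof.
move=> sepS sepZ p wp; have /last_split[p0 [z [s [def_p zS p0S]]]] := sepS p wp.
move: wp; rewrite def_p walk_cat => /andP[_ /and3P[_ zs lB]].
rewrite has_cat; apply/orP; right; apply: sepZ; rewrite /walk zS lB andbT /=.
apply: del_edge_path_end => //.
apply/negP=> xp; case/negP: p0S; apply/hasP; exists y => //=.
exact: setU11.
Qed.

(* Trimming each walk at its first, resp. last, vertex in the target, resp.
   source, set leaves that vertex as the only one in the set. *)
Lemma disjoint_walks_end r A B k : disjoint_walks r A B k ->
  exists (p : 'I_k -> seq T) (t : 'I_k -> T),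
    [/\ forall i, walk r A [set t i] (rcons (p i) (t i)),
        forall i, t i \in B, forall i, ~~ has [in B] (p i)
      & forall i j, i != j ->
          [disjoint rcons (p i) (t i) & rcons (p j) (t j)]].
Proof.
case=> f [fw fd].
have /fin_all_exists[p /fin_all_exists[t pP]] i : exists p t,
    [/\ walk r A [set t] (rcons p t), t \in B, ~~ has [in B] p
      & {subset rcons p t <= f i}].
  have /first_split[p0 [z [s [def_p zS p0S]]]] : has [in B] (f i).
    have := fw i; case: (f i) => // x s /and3P[_ _ lB].
    by apply/hasP; exists (last x s); rewrite ?mem_last.
  exists p0, z; split=> //; first by move: (fw i); rewrite def_p walk_cat => /andP[].
  by move=> u; rewrite def_p -cat_rcons mem_cat => ->.
exists p, t; split=> [i|i|i|i j /fd/disjoint_seqP ij]; try by case: (pP i).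
have [[_ _ _ si] [_ _ _ sj]] := (pP i, pP j).
by apply/disjoint_seqP=> u /si ui /sj; apply: ij ui.
Qed.

Lemma disjoint_walks_start r A B k : disjoint_walks r A B k ->
  exists (t : 'I_k -> T) (p : 'I_k -> seq T),
    [/\ forall i, walk r [set t i] B (t i :: p i),
        forall i, t i \in A, forall i, ~~ has [in A] (p i)
      & forall i j, i != j -> [disjoint t i :: p i & t j :: p j]].
Proof.
case=> f [fw fd].
have /fin_all_exists[t /fin_all_exists[p pP]] i : exists t p,
    [/\ walk r [set t] B (t :: p), t \in A, ~~ has [in A] p
      & {subset t :: p <= f i}].
  have /last_split[p0 [z [s [def_p zS p0S]]]] : has [in A] (f i).
    by have := fw i; case: (f i) => //= x s /and3P[-> _ _].
  exists z, s; split=> //; first by move: (fw i); rewrite def_p walk_cat => /andP[].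
  by move=> u us; rewrite def_p mem_cat us orbT.
exists t, p; split=> [i|i|i|i j /fd/disjoint_seqP ij]; try by case: (pP i).
have [[_ _ _ si] [_ _ _ sj]] := (pP i, pP j).
by apply/disjoint_seqP=> u /si ui /sj; apply: ij ui.
Qed.

(** Here every walk is a single vertex of [A :&: B]. *)
Lemma menger_edgeless r A B k : (forall u v, ~~ r u v) ->
  (exists2 S : {set T}, #|S| < k & separates r A B S) \/ disjoint_walks r A B k.
Proof.
move=> r0; have [ltk | lek] := ltnP #|A :&: B| k; [left | right].
  exists (A :&: B) => // -[|x [|y s]] //=; last by rewrite (negPf (r0 x y)) andbF.
  by rewrite inE orbF => ->.
exists (fun i => [:: enum_val (widen_ord lek i)]); split=> [i|i j ij] /=.
  by have := enum_valP (widen_ord lek i); rewrite inE.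
rewrite disjoint_has /= inE orbF (inj_eq enum_val_inj).
by apply: contra ij => /eqP/(congr1 val)/= /val_inj->.
Qed.

(* Goring's induction: [S] separates [A] from [B] once the edge [xy] is
   deleted, so the two families of walks meet only in [S] and are glued there
   and along [xy]. *)
Lemma glue_walks r x y A B S k :
  r x y -> #|y |: S| <= k -> x \notin S -> y \notin S ->
  separates (del_edge r x y) A B S ->
  disjoint_walks (del_edge r x y) A (x |: S) k ->
  disjoint_walks (del_edge r x y) (y |: S) B k ->
  disjoint_walks r A B k.
Proof.
move=> rxy cardS xS yS sepS /disjoint_walks_end[p [t [pw tS pS pd]]].
move=> /disjoint_walks_start[u [q [qw uS qS qd]]].
have u_inj : injective u.
  move=> i j uij; apply/eqP/negPn/negP=> /qd/disjoint_seqP/(_ (u i)).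
  by apply; [|rewrite uij]; apply: mem_head.
(* The [k] distinct starts lie in [y |: S], which has at most [k] elements, so they fill it. *)
have u_onto z : z \in y |: S -> exists i, u i = z.
  have -> : y |: S = [set u i | i in 'I_k].
    apply/esym/eqP; rewrite eqEcard card_imset // card_ord cardS andbT.
    by apply/subsetP=> _ /imsetP[i _ ->].
  by case/imsetP=> i _ ->; exists i.
(* [m i] is the index of the walk continuing walk [i]: it starts at [t i], or at [y] when [t i] is
   [x]. *)
have /fin_all_exists[m mP] i : exists j, u j = if t i == x then y else t i.
  apply: u_onto; have := tS i; rewrite !inE; case: (t i == x) => /= [_|->].
    by rewrite eqxx.
  by rewrite orbT.
(* Following walk [i] to [v] and then walk [j] gives a walk from [A] to [B] without the arc [xy], so
   it meets [S]. After trimming this can only happen at [t i] or [u j], which forces [v] to be that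
   vertex. *)
have meet i j v : v \in rcons (p i) (t i) -> v \in u j :: q j -> v = t i /\ v = u j.
  have uniq_t w : w \in rcons (p i) (t i) -> w \in S -> w = t i.
    rewrite mem_rcons inE => /predU1P[//|wp] wS; case/hasP: (pS i).
    by exists w; rewrite //= inE wS orbT.
  have uniq_u w : w \in u j :: q j -> w \in S -> w = u j.
    rewrite inE => /predU1P[//|wp] wS; case/hasP: (qS j).
    by exists w; rewrite //= inE wS orbT.
  move=> vp vq; have [vp0 [vp1 def_p]] : exists p0 p1, rcons (p i) (t i) = p0 ++ v :: p1.
    by case/splitPr: vp => p0 p1; exists p0, p1.
  have [vq0 [vq1 def_q]] : exists q0 q1, u j :: q j = q0 ++ v :: q1.
    by case/splitPr: vq => q0 q1; exists q0, q1.
  have := pw i; rewrite def_p walk_cat => /andP[wp _].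
  have := qw j; rewrite def_q walk_cat => /andP[_ wq].
  have /hasP[w wpq /= wS] : has [in S] (vp0 ++ v :: vq1).
    by apply: sepS; rewrite walk_cat wp.
  move: wpq; rewrite -cat_rcons mem_cat => /orP[wp0|wq1].
    have wt : w = t i.
      apply: uniq_t wS; rewrite def_p -cat_rcons mem_cat wp0 //.
    suffices vt : v = t i by split=> //; apply: uniq_u; rewrite // vt -wt.
    move: wp0; rewrite mem_rcons inE => /predU1P[<- //|wp0].
    case: (lastP vp1) def_p => [|vp2 z].
      by rewrite cats1 => /rcons_inj[_ ->].
    rewrite -rcons_cons -rcons_cat => /rcons_inj[def_pi _].
    case/hasP: (pS i); exists w; last by rewrite /= inE wS orbT.
    by rewrite def_pi mem_cat wp0.
  have wu : w = u j.
    by apply: uniq_u wS; rewrite def_q mem_cat inE wq1 !orbT.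
  suffices vu : v = u j by split=> //; apply: uniq_t; rewrite // vu -wu.
  case: vq0 def_q => [[->] //|z vq2 [_ def_qj]].
  case/hasP: (qS j); exists w; last by rewrite /= inE wS orbT.
  by rewrite def_qj mem_cat inE wq1 !orbT.
have t_inj i j : t i = t j -> i = j.
  move=> tij; apply/eqP/negPn/negP=> /pd/disjoint_seqP/(_ (t i)).
  by apply; [|rewrite tij]; rewrite mem_rcons mem_head.
(* As [y] is not in [S], [t i = y] can occur only for a loop [x = y]; the claim holds then too. *)
have t_m i j : t i = u (m j) -> i = j.
  rewrite mP; case: eqP => [tj ti|_ /t_inj//]; apply: t_inj.
  by have := tS i; rewrite !inE {2}ti (negPf yS) orbF tj => /eqP.
have m_inj i j : m i = m j -> i = j.
  move=> mij; have := mP i; rewrite mij; case: eqP => [ti|_ /esym/t_m//].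
  rewrite mP; case: eqP => [tj _|_ tj]; apply: t_inj; first by rewrite ti.
  have := tS j; rewrite tj !inE (negPf yS) orbF => /eqP yx.
  by rewrite ti yx.
(* Across the arc [xy] both [t i] and [u (m i)] are listed; otherwise they are the same vertex,
   listed once. *)
pose g i := if t i == x then rcons (p i) (t i) ++ u (m i) :: q (m i)
            else p i ++ u (m i) :: q (m i).
have g_sub i v : v \in g i -> v \in rcons (p i) (t i) \/ v \in u (m i) :: q (m i).
  rewrite /g; case: ifP => _; rewrite mem_cat => /orP //.
  by rewrite mem_rcons inE; case=> ->; rewrite ?orbT; auto.
exists g; split=> [i|i j ij].
  have [wp wq] := (del_edge_walk (pw i), del_edge_walk (qw (m i))).
  rewrite /g; case: eqP (mP i) => [tx uy|_ ut].
    rewrite cat_rcons walk_cat wp /= set11 tx uy rxy.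
    by move: wq; rewrite /= uy => /andP[].
  by rewrite walk_cat wq andbT ut.
have mij : m i != m j by apply: contra ij => /eqP/m_inj->.
apply/disjoint_seqP=> v /g_sub[] vi /g_sub[] vj.
- exact: (disjoint_seqP _ _ (pd _ _ ij)) vi vj.
- by have [vt vu] := meet _ _ _ vi vj; case/eqP: ij; apply: t_m; rewrite -vt.
- by have [vt vu] := meet _ _ _ vj vi; case/eqP: ij; apply/esym/t_m; rewrite -vt.
- exact: (disjoint_seqP _ _ (qd _ _ mij)) vi vj.
Qed.

(** Induction on the number of arcs, deleting one arc [xy]. A small separator [S] of the rest
    becomes a separator for [r] by adding [x] or [y]. If both enlarged sets have at least [k]
    elements, induction from [A] to [x |: S] and from [y |: S] to [B] gives a small separator or two
    families to glue. *)
Theorem menger r A B k :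
  (exists2 S : {set T}, #|S| < k & separates r A B S) \/ disjoint_walks r A B k.
Proof.
have [n] := ubnP #|[set uv | r uv.1 uv.2]|.
elim: n r A B => // n IHn r A B; rewrite ltnS => ltn.
case: (pickP (fun uv => r uv.1 uv.2)) => [[x y] /= rxy | r0]; last first.
  by apply: menger_edgeless => u v; rewrite (r0 (u, v)).
have {}IHn A' B' :
    (exists2 S : {set T}, #|S| < k & separates (del_edge r x y) A' B' S) \/
    disjoint_walks (del_edge r x y) A' B' k.
  apply: IHn; apply: leq_trans ltn; apply: proper_card; apply/properP; split.
    by apply/subsetP=> uv; rewrite !inE => /andP[].
  by exists (x, y); rewrite !inE //= /del_edge eqxx andbF.
have [[S ltS sepS]|[f [fw fd]]] := IHn A B; last first.
  by right; exists f; split=> // i; apply: del_edge_walk (fw i).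
have [sepx sepy] := separates_del_edge sepS.
have [ltx|lex] := ltnP #|x |: S| k; first by left; exists (x |: S).
have [lty|ley] := ltnP #|y |: S| k; first by left; exists (y |: S).
have [[Z ltZ sepZ]|wx] := IHn A (x |: S).
  by left; exists Z => //; apply: separates_start sepZ.
have [[Z ltZ sepZ]|wy] := IHn (y |: S) B.
  by left; exists Z => //; apply: separates_end sepZ.
right; apply: glue_walks wx wy => //.
  by apply: leq_trans ltS; rewrite cardsU1 -add1n leq_add2r leq_b1.
  by apply: contraTN ltS => xS; rewrite -leqNgt (leq_trans lex) // cardsU1 xS.
by apply: contraTN ltS => yS; rewrite -leqNgt (leq_trans ley) // cardsU1 yS.
Qed.

End Menger.

(** * Contracting the paths of a linkage *)

Section Contraction.

Variables (T : finType) (e : rel T).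
Implicit Types (A B X S R Y : {set T}) (p q : T -> seq T).

Definition indexed_linkage A B p : Prop :=
  (forall a, a \in A -> ohead (p a) = Some a /\ path_between e A B (p a)) /\
  {in A &, forall a b, a != b -> [disjoint p a & p b]}.

Definition vertices p S : {set T} := [set v | [exists a in S, v \in p a]].

Lemma verticesP p S v :
  reflect (exists2 a, a \in S & v \in p a) (v \in vertices p S).
Proof. by rewrite inE; apply: exists_inP. Qed.

Lemma verticesS p S R : S \subset R -> vertices p S \subset vertices p R.
Proof.
move=> SR; apply/subsetP=> v /verticesP[a aS va]; apply/verticesP.
by exists a; rewrite ?(subsetP SR).
Qed.

(* The arcs of the digraph in which every path [p a], [a \in S], is contracted
   to its first vertex [a]; arcs into contracted paths are dropped. *)
Definition contract p S : rel T := fun u v =>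
  (v \notin vertices p S) &&
  (if u \in S then [exists w, (w \in p u) && e w v] else e u v).

Lemma linkage_head A B p a : indexed_linkage A B p -> a \in A -> a \in p a.
Proof.
by case=> pP _ /pP[]; case: (p a) => //= x s [->] _; apply: mem_head.
Qed.

Lemma linkage_inj A B p a b v : indexed_linkage A B p ->
  a \in A -> b \in A -> v \in p a -> v \in p b -> a = b.
Proof.
move=> [_ pd] aA bA va vb; apply/eqP/negPn/negP=> ab.
exact: (disjoint_seqP _ _ (pd a b aA bA ab)) va vb.
Qed.

Lemma contract_path_avoids p S a s : a \notin vertices p S ->
  path (contract p S) a s -> ~~ has [in vertices p S] (a :: s).
Proof.
elim: s a => [|b s IHs] a aS; first by rewrite /= orbF.
move=> /= /andP[/andP[bS _] /(IHs _ bS) nS].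
by rewrite [has _ _]/= negb_or aS.
Qed.

(** * Translating separators and disjoint walks back to the original graph *)

Section Cut.

Variables (A B X : {set T}) (p : T -> seq T) (S : {set T}).
Hypotheses (linkp : indexed_linkage A B p) (subSA : S \subset A).
Hypothesis pX : [disjoint vertices p A & X].

Let sS : S \subset vertices p S.
Proof.
apply/subsetP=> a aS; apply/verticesP; exists a => //.
by apply: linkage_head linkp _; apply: (subsetP subSA).
Qed.

Let path_contract a s : ~~ has [in vertices p S] (a :: s) ->
  path (contract p S) a s = path e a s.
Proof.
move=> nS; apply: (eq_in_path (P := [pred u | u \notin vertices p S])).
  move=> u v /= uS vS; rewrite /contract (vS : v \notin _) /=.
  by case: ifP => // /(subsetP sS) uS'; rewrite inE uS' in uS.
by rewrite all_predC.
Qed.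

(** A vertex of [Z] in [S] stands for a whole contracted path, the others for themselves. Past the
    last vertex on a path of [S :\: Z], a tail missing both kinds would avoid all contracted paths
    and give a walk of the contraction missing [Z]. *)
Lemma separator_cut Z : separates (contract p S) S X Z ->
  forall v s, v \in vertices p (S :\: Z) -> path e v s -> last v s \in X ->
    has [in vertices p (Z :&: S) :|: (Z :\: S)] s.
Proof.
move=> sepZ v s vS ps lX.
have /last_split[s0 [z [s1 [def_s zS s1S]]]] :
  has [in vertices p (S :\: Z)] (v :: s) by rewrite /= vS.
have sub_s : {subset s1 <= s}.
  case: s0 def_s => [[_ ->] //|v' s0 [_ ->]] u us.
  by rewrite mem_cat inE us !orbT.
have [ps1 lX1] : path e z s1 /\ last z s1 \in X.
  case: s0 def_s ps lX => [[-> ->] //|v' s0 [_ ->]].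
  by rewrite cat_path last_cat /= => /andP[_ /andP[_ ->]].
suffices /hasP[u us uZ] : has [in vertices p (Z :&: S) :|: (Z :\: S)] s1.
  by apply/hasP; exists u; rewrite ?sub_s.
apply: contraT => s1Z; have [a] := verticesP _ _ _ zS.
rewrite inE => /andP[aZ aS] za.
have s1V : ~~ has [in vertices p S] s1.
  apply/hasPn=> u us; apply/negP=> /verticesP[b bS ub].
  have [bZ|bZ] := boolP (b \in Z).
    case/hasP: s1Z; exists u; rewrite //= inE; apply/orP; left.
    by apply/verticesP; exists b; rewrite // inE bZ.
  by case/hasP: s1S; exists u => //=; apply/verticesP; exists b; rewrite // inE bZ.
have /hasP[u] : has [in Z] (a :: s1).
  apply: sepZ; rewrite /= aS /=.
  (* An empty tail would put [z] in [X], which the linkage avoids. *)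
  case: s1 ps1 lX1 s1V {sub_s def_s s1S s1Z} => [_ zX|b s1 /= /andP[zb ps1] -> s1V].
    have zA : z \in vertices p A.
      by apply: subsetP zS; apply: verticesS; apply: subset_trans subSA; apply: subsetDl.
    by rewrite (disjointFr pX zA) in zX.
  rewrite andbT path_contract // ps1 andbT /contract aS.
  move: s1V; rewrite negb_or => /andP[-> _] /=.
  by apply/existsP; exists z; rewrite za.
rewrite inE => /predU1P[->|us] /= uZ; first by rewrite uZ in aZ.
case/hasP: s1Z; exists u; rewrite //= in_setU in_setD uZ andbT orbC.
apply/orP; left; apply: contra (hasPn s1V u us); exact: (subsetP sS).
Qed.

(** The first arc of a walk leaves the contracted path [p a] at a real vertex [w], where the path to
    [X] begins. No arc enters a contracted path, so [w] is its only vertex on paths of [S]. *)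
Lemma contract_crossbar k :
  disjoint_walks (contract p S) S X k -> has_crossbar e A B X k.
Proof.
case=> f [fw fd].
have /fin_all_exists[a /fin_all_exists[w /fin_all_exists[s fP]]] i :
    exists a w s, [/\ a \in S, w \in p a, ~~ has [in vertices p S] s,
      {subset a :: s <= f i} & path_between e [in p a] X (w :: s)].
  have := fw i; case: (f i) => // a s /and3P[aS ps lX].
  have aA : a \in vertices p A.
    by apply/verticesP; exists a; rewrite ?(linkage_head linkp) ?(subsetP subSA).
  case: s ps lX => [_ aX|b s /= /andP[]].
    by rewrite (disjointFr pX aA) in aX.
  rewrite {1}/contract aS => /andP[bS /existsP[w /andP[wa wb]]] ps lX.
  have sS' : ~~ has [in vertices p S] (b :: s).
    exact: contract_path_avoids.
  rewrite path_contract // in ps.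
  case/shortenP: ps lX => s' ps' us' sub_s lX.
  have sS2 : ~~ has [in vertices p S] (b :: s').
    apply: contra sS' => /hasP[u us uV]; apply/hasP; exists u => //.
    by move: us; rewrite !inE => /predU1P[->|/sub_s->]; rewrite ?eqxx ?orbT.
  exists a, w, (b :: s'); split=> //.
    by move=> u; rewrite !inE => /or3P[->|->|/sub_s->] //; rewrite !orbT.
  rewrite /path_between /is_path cons_uniq us' andbT /= wb ps' lX wa /= !andbT.
  apply: contra sS2 => ws; apply/hasP; exists w => //=.
  by apply/verticesP; exists a.
have wV i : w i \in vertices p S.
  by case: (fP i) => aS wa _ _ _; apply/verticesP; exists (a i).
have aA i : a i \in A by case: (fP i) => aS _ _ _ _; apply: (subsetP subSA).
have a_inj : injective a.
  move=> i j aij; apply/eqP/negPn/negP=> /fd/disjoint_seqP/(_ (a i)).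
  case: (fP i) (fP j) => [_ _ _ si _] [_ _ _ sj _].
  by apply; [apply: si|apply: sj; rewrite aij]; apply: mem_head.
have pa_inj : injective (p \o a).
  move=> i j /= pij; apply: a_inj; apply: (linkage_inj linkp (aA i) (aA j) (v := a i)).
    exact: linkage_head linkp _.
  by rewrite -pij; apply: linkage_head linkp _.
have p_s i j u : u \in p (a i) -> u \in w j :: s j -> i = j /\ u = w j.
  move=> ui; have [_ wj sj _ _] := fP j; rewrite inE => /predU1P[uw|us].
    split=> //; apply: a_inj; apply: (linkage_inj linkp (aA i) (aA j) ui).
    by rewrite uw.
  case/hasP: sj; exists u => //=; apply/verticesP; exists (a i) => //.
  by case: (fP i).
pose Qs x := if [pick i | p (a i) == x] is Some i then w i :: s i else [::].
have QsE i : Qs (p (a i)) = w i :: s i.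
  rewrite /Qs; case: pickP => [j /eqP/pa_inj-> //|/(_ i)].
  by rewrite eqxx.
exists [fset p (a i) | i in 'I_k]%fset, Qs; split.
- by rewrite card_imfset //= -cardE card_ord.
- move=> _ _ /imfsetP[/= i _ ->] /imfsetP[/= j _ ->] ij.
  by apply: linkp.2; rewrite // ?(inj_eq a_inj); apply: contra ij => /eqP->.
- move=> _ /imfsetP[/= i _ ->]; have [_ wi _ _ pbi] := fP i.
  have [_ pbB] := linkp.1 _ (aA i).
  rewrite QsE; split=> //; exists (w i); first exact: mem_head.
  move=> u; apply/andP/eqP=> [[ui us]|->]; last by rewrite mem_head.
  by have [] := p_s i i u ui us.
move=> _ _ /imfsetP[/= i _ ->] /imfsetP[/= j _ ->]; rewrite !QsE => pij.
have ij : i != j by apply: contra pij => /eqP->.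
have [[_ wi si subi _] [_ wj sj subj _]] := (fP i, fP j).
split; apply/disjoint_seqP=> u ui uj.
  (* A common vertex on a contracted path would be [w i], on [p (a i)]; any other would lie on both
     disjoint walks [f i] and [f j]. *)
  have [uV|uV] := boolP (u \in vertices p S).
    have no_s l : ~~ has [in vertices p S] (s l) -> u \in w l :: s l -> u = w l.
      move=> sl; rewrite inE => /predU1P[//|us]; case/hasP: sl; by exists u.
    have upi : u \in p (a i) by rewrite (no_s _ si ui).
    by have [/eqP] := p_s i j u upi uj; rewrite (negPf ij).
  have no_w l : u \in w l :: s l -> u \in a l :: s l.
    by rewrite !inE => /predU1P[uw|->]; [rewrite uw wV in uV | rewrite orbT].
  exact: (disjoint_seqP _ _ (fd _ _ ij) u) (subi _ (no_w _ ui)) (subj _ (no_w _ uj)).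
by have [/eqP] := p_s i j u ui uj; rewrite (negPf ij).
Qed.

(** The hit is required in [s], after the start [v], because the tails counted later omit [v]. *)
Definition cut k S R Y : Prop :=
  [/\ R \subset S, #|R| + #|Y| < k
    & forall v s, v \in vertices p (S :\: R) -> path e v s -> last v s \in X ->
        has [in vertices p R :|: Y] s].

Lemma crossbar_or_cut k :
  has_crossbar e A B X k \/ exists R Y, cut k S R Y.
Proof.
have [[Z ltZ /separator_cut cutZ]|/contract_crossbar] :=
  menger (contract p S) S X k; last by left.
right; exists (Z :&: S), (Z :\: S); split; first exact: subsetIr.
  by rewrite cardsID.
by move=> v s vS; apply: cutZ; rewrite setIC setDIr setDv set0U in vS.
Qed.

End Cut.

End Contraction.

(** * Counting hits, indexing linkages, degrees along paths *)

(** Choosing a vertex of [Y] on each sequence is injective by disjointness. *)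
Lemma card_disjoint_hits (T : finType) (I Y : {set T}) (s : T -> seq T) :
  {in I &, forall a b, a != b -> [disjoint s a & s b]} ->
  (forall a, a \in I -> has [in Y] (s a)) -> #|I| <= #|Y|.
Proof.
move=> sd sY.
have /fin_all_exists[h hP] a : exists y, a \in I -> y \in s a /\ y \in Y.
  have [/sY/hasP[y ys yY]|_] := boolP (a \in I); first by exists y.
  by exists a.
have h_inj : {in I &, injective h}.
  move=> a b aI bI hab; apply/eqP/negPn/negP=> /(sd _ _ aI bI)/disjoint_seqP.
  by move/(_ (h a)); apply; [case: (hP a)|rewrite hab; case: (hP b)].
rewrite -(card_in_imset h_inj); apply: subset_leq_card.
by apply/subsetP=> _ /imsetP[a /hP[_ ?] ->].
Qed.

Lemma subset_of_card (T : finType) (A : {set T}) k : k <= #|A| ->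
  exists2 B : {set T}, B \subset A & #|B| = k.
Proof.
case/card_geqP=> s [us <- sA]; exists [set x in s].
  by apply/subsetP=> x; rewrite inE => /sA.
by rewrite cardsE; apply/card_uniqP.
Qed.

(** By disjointness only one path starts at a given vertex of [A]. *)
Lemma linkage_indexed (T : finType) (e : rel T) (A B : {set T}) (P : {fset seq T}) :
  linkage e A B P -> exists p : T -> seq T,
    [/\ indexed_linkage e A B p, forall a, a \in A -> p a \in P
      & forall x, x \in P -> exists2 a, a \in A & x = p a].
Proof.
case=> _ Ppath Pd PA.
have /fin_all_exists[p pP] a :
    exists x, a \in A -> x \in P /\ ohead x = Some a.
  have [/PA[x xP xa]|_] := boolP (a \in A); first by exists x.
  by exists [::].
have uniq_p x a : x \in P -> a \in A -> ohead x = Some a -> x = p a.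
  move=> xP aA xa; have [yP ya] := pP a aA.
  apply/eqP/negPn/negP=> /(Pd _ _ xP yP)/disjoint_seqP/(_ a).
  case: x (p a) xa ya {xP yP} => [|x s] [|y t] //= [->] [->].
  by rewrite !mem_head; apply.
exists p; split=> [|a /pP[]//|x xP].
  split=> [a /pP[pa ha]|a b aA bA ab]; first by split=> //; apply: Ppath.
  have [[paP ha] [pbP hb]] := (pP a aA, pP b bA).
  by apply: Pd => //; apply: contraNneq ab => pab; move: ha; rewrite pab hb => -[->].
have := Ppath x xP; case: x xP => [|a s] xP; rewrite /path_between //.
by case/and3P=> _ aA _; exists a => //; apply: uniq_p.
Qed.

Lemma companion_indexed (T : finType) (e : rel T) (A B X : {set T})
    (Q : {fset seq T}) (p q : T -> seq T) a :
  indexed_linkage e A B p -> indexed_linkage e A X q ->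
  (forall b, b \in A -> q b \in Q) ->
  (forall x, x \in Q -> exists2 b, b \in A & x = q b) ->
  a \in A -> companion Q (p a) = q a.
Proof.
move=> [pP _] [qP _] qQ Qq aA; rewrite /companion.
have [[-> _] [qa _]] := (pP a aA, qP a aA).
have : q a \in [seq x <- enum_fset Q | ohead x == Some a].
  by rewrite mem_filter qa eqxx; apply: qQ.
set s := filter _ _; have : {subset s <= [:: q a]}.
  move=> x; rewrite mem_filter => /andP[/eqP xa /Qq[b bA def_x]].
  by move: xa; rewrite def_x (qP b bA).1 => -[->]; apply: mem_head.
case: s => //= x s sq _; have := sq x (mem_head _ _).
by rewrite inE => /eqP.
Qed.

(** The vertices before and after [y] are distinct neighbours of it. This keeps vertices of degree 1
    out of the interior of paths. *)
Lemma inner_degree (T : finType) (e : rel T) l v y z r :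
  symmetric e -> is_path e (l ++ [:: v, y, z & r]) -> 1 < #|[set u | e y u]|.
Proof.
move=> e_sym pl.
have /and3P[evy eyz] : [&& e v y, e y z & v != z].
  move: pl; case: l => [|x l] /=.
    by rewrite !inE !negb_or -!andbA => /and4P[-> -> _ /and3P[_ -> _]].
  rewrite cat_path /= cat_uniq /= !inE !negb_or -!andbA.
  by case/and5P=> _ _ -> -> /and5P[_ _ _ _ /and5P[_ _ _ _ /andP[-> _]]].
move=> vz.
have : [set v; z] \subset [set u | e y u].
  by apply/subsetP=> u; rewrite !inE => /orP[/eqP->|/eqP->]; rewrite // e_sym.
by move/subset_leq_card; rewrite cards2 vz.
Qed.

(** A vertex of degree 1 can only be an end of a path, and the ends lie in [A] and [B]. *)
Lemma vertices_disjoint_ends (T : finType) (e : rel T) (A B X : {set T}) p :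
  symmetric e -> [disjoint A & X] -> [disjoint B & X] ->
  (forall x, x \in X -> #|[set y | e x y]| = 1) ->
  indexed_linkage e A B p -> [disjoint vertices p A & X].
Proof.
move=> e_sym AX BX degX [pP _]; rewrite disjoint_subset.
apply/subsetP=> x /verticesP[a aA xa]; rewrite inE; apply/negP=> xX.
have [ha /andP[pa pB]] := pP a aA; case/splitPr: xa pa ha pB => l r.
case: (lastP l) => [_ [xa]|{}l v]; first by rewrite xa (disjointFr AX aA) in xX.
rewrite cat_rcons; case: r => [_ _|z r pl _ _]; last first.
  by have := inner_degree e_sym pl; rewrite degX.
have: last x (l ++ [:: v; x]) = x by rewrite last_cat.
case: l => [|y l] /= lx /andP[_]; first by rewrite (disjointFl BX xX).
by rewrite lx (disjointFl BX xX).
Qed.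

(** * Iterated cuts *)

Section CutSequence.

Variables (T : finType) (e : rel T) (A B X : {set T}) (p : T -> seq T).
Hypothesis linkp : indexed_linkage e A B p.
Hypothesis pX : [disjoint vertices p A & X].

Lemma cut_sequence k : ~ has_crossbar e A B X k ->
  exists S R Y : nat -> {set T},
    [/\ S 0 = A, forall i, S i.+1 = S i :\: R i, forall i, S i \subset A
      & forall i, cut e X p k (S i) (R i) (Y i)].
Proof.
move=> nocross.
(* Choosing the cut as a function of [S] turns the sequence into a plain iteration. *)
have /fin_all_exists[R /fin_all_exists[Y cutP]] (S : {set T}) :
    exists R Y, S \subset A -> cut e X p k S R Y.
  have [SA|] := boolP (S \subset A); last by exists set0, set0.
  by have [//|[R [Y ?]]] := crossbar_or_cut linkp SA pX k; exists R, Y.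
pose S i := iter i (fun S => S :\: R S) A.
have SA i : S i \subset A.
  by elim: i => [|i IHi] //=; apply: subset_trans IHi; apply: subsetDl.
by exists S, (R \o S), (Y \o S); split=> // i; apply: cutP.
Qed.

End CutSequence.

(** * Building the pseudo-grid from the cuts *)

Theorem theorem4p2 (g kappa : nat) (g_ge1 : 1 <= g) (kappa_ge1 : 1 <= kappa)
    (T : finType) (e : rel T) (e_sym : symmetric e) (e_irr : irreflexive e)
    (A B X : {set T})
    (disjAB : [disjoint A & B]) (disjAX : [disjoint A & X])
    (disjBX : [disjoint B & X])
    (cardA : #|A| = kappa) (cardB : #|B| = kappa) (cardX : #|X| = kappa)
    (degX : forall x, x \in X -> #|[set y | e x y]| = 1)
    (P Q : {fset seq T}) (minPQ : min_linkages e A B X P Q)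
    (D : nat) (D_ge1 : 1 <= D) (D_le : D * (2 * g ^ 2) <= kappa) :
  has_crossbar e A B X (g ^ 2) \/ has_pseudo_grid X P Q g kappa D.
Proof.
have [|nocross] := classic (has_crossbar e A B X (g ^ 2)); [by left | right].
case: minPQ => /linkage_indexed[p [linkp pP Pp]] /linkage_indexed[q [linkq qQ Qq]] _.
have pX := vertices_disjoint_ends e_sym disjAX disjBX degX linkp.
have [S [R [Y [S0 SS SA cutP]]]] := cut_sequence linkp pX nocross.
set k := g ^ 2 in nocross cutP *.
have k_gt0 : 0 < k by rewrite expn_gt0 g_ge1.
have S_mono i j : i <= j -> S j \subset S i.
  elim: j => [|j IHj]; first by rewrite leqn0 => /eqP->.
  rewrite leq_eqVlt ltnS => /predU1P[-> //|/IHj]; apply: subset_trans.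
  by rewrite SS subsetDl.
have S_card i : kappa <= #|S i| + i * k.-1.
  elim: i => [|i IHi]; first by rewrite S0 cardA addn0.
  have [RS ltk _] := cutP i.
  by rewrite SS cardsD (setIidPr RS); lia.
(* The vertex [a] lies on both [q a] and [p a], so [q a] has a last vertex on a path of [S D]. *)
have qP a : a \in S D -> exists l v s,
    [/\ q a = l ++ v :: s, v \in vertices p (S D) & ~~ has [in vertices p (S D)] s].
  move=> aS; apply: last_split; apply/hasP; exists a.
    by apply: linkage_head linkq _; apply: subsetP (SA D) _ aS.
  apply/verticesP; exists a => //.
  by apply: linkage_head linkp _; apply: subsetP (SA D) _ aS.
have /fin_all_exists[l /fin_all_exists[v /fin_all_exists[s sP]]] a : exists l v s,
    a \in S D -> [/\ q a = l ++ v :: s, v \in vertices p (S D)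
       & ~~ has [in vertices p (S D)] s].
  have [/qP[l [v [s ?]]]|_] := boolP (a \in S D); first by exists l, v, s.
  by exists [::], a, [::].
have s_path a : a \in S D -> path e (v a) (s a) /\ last (v a) (s a) \in X.
  move=> aS; have aA := subsetP (SA D) a aS; have [qa _ _] := sP a aS.
  have [_ /andP[]] := linkq.1 a aA; rewrite qa.
  case: (l a) => [|y l'] /=; first by move=> /andP[-> _] /andP[].
  rewrite cat_path last_cat /= => /andP[/andP[_ /andP[_ ->]] _].
  by move=> /andP[_ ->].
(* [v a] lies on a path of [S D], hence of [S i.+1 = S i :\: R i], so cut [i] applies to the
   tail. *)
have s_hits a i : a \in S D -> i < D -> has [in vertices p (R i) :|: Y i] (s a).
  move=> aS iD; have [_ _ cuti] := cutP i; have [sp sX] := s_path a aS.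
  apply: cuti sp sX; rewrite -SS; have [_ va _] := sP a aS.
  by apply: subsetP va; apply/verticesS/S_mono.
have s_disj : {in S D &, forall a b, a != b -> [disjoint s a & s b]}.
  move=> a b aS bS ab; apply/disjoint_seqP=> u ua ub.
  have [[qa _ _] [qb _ _]] := (sP a aS, sP b bS).
  case/eqP: ab; apply: (linkage_inj linkq (v := u)).
  - exact: subsetP (SA D) a aS.
  - exact: subsetP (SA D) b bS.
  - by rewrite qa mem_cat inE ua !orbT.
  - by rewrite qb mem_cat inE ub !orbT.
(* The tails kept must meet a path of [R D.-1], which avoids [X]; this excludes tails with one
   vertex. *)
pose I := [set a in S D | ~~ has [in Y D.-1] (s a)].
(* In the last cut [R] and [Y] together cost at most [k - 1], so [#|I| >= kappa - D * (k - 1)],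
   which is at least [kappa / 2 + D]. *)
have I_card : (kappa + 3) %/ 4 <= #|I|.
  have : #|S D :\: I| <= #|Y D.-1|.
    apply: (card_disjoint_hits (s := s)) => [a b|a].
      by move=> /setDP[aS _] /setDP[bS _]; apply: s_disj.
    by rewrite !inE => /andP[+ aS]; rewrite aS negbK.
  have IS : I \subset S D by apply/subsetP=> a; rewrite inE => /andP[].
  rewrite cardsD (setIidPr IS).
  have [RS ltk _] := cutP D.-1; have := S_card D.-1.
  have := SS D.-1; rewrite prednK // => ->.
  by rewrite cardsD (setIidPr RS); nia.
have [J JI J_card] := subset_of_card I_card.
have JS a : a \in J -> a \in S D by move/(subsetP JI); rewrite inE => /andP[].
have sE a : a \in J -> exists y z r, s a = [:: y, z & r].
  move=> aJ; have aS := JS a aJ; have [_ va _] := sP a aS.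
  have [sp sX] := s_path a aS; move: (s_hits a D.-1 aS).
  have := subsetP JI a aJ; rewrite inE => /andP[_].
  have vX : v a \notin X.
    by rewrite (disjointFr pX) // (subsetP (verticesS p (SA D))).
  case: (s a) sX => [vX'|y [|z r] yX]; first by rewrite vX' in vX.
    rewrite /= !orbF inE => /negPf-> /(_ _)/orP[]// => [|yR].
      by rewrite prednK.
    have [RS _ _] := cutP D.-1.
    have RA := subset_trans RS (SA D.-1).
    by have := subsetP (verticesS p RA) y yR; rewrite (disjointFl pX yX).
  by exists y, z, r.
have s_inj : {in J &, injective s}.
  move=> a b aJ bJ sab; apply/eqP/negPn/negP=> /(s_disj _ _ (JS a aJ) (JS b bJ)).
  have [y [z [r sa]]] := sE a aJ.
  by move/disjoint_seqP/(_ y); apply; rewrite -?sab sa mem_head.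
(* Recovers [q a] from its tail; the default is taken only off the chosen tails. *)
pose f x := if [pick a in J | s a == x] is Some a then q a else [::].
have fE a : a \in J -> f (s a) = q a.
  move=> aJ; rewrite /f; case: pickP => [b /andP[bJ /eqP/s_inj->] //|/(_ a)].
  by rewrite aJ eqxx.
have p_inj : {in A &, injective p}.
  move=> a b aA bA pab; apply: (linkage_inj linkp aA bA (v := a)).
    exact: linkage_head linkp aA.
  by rewrite -pab; apply: linkage_head linkp aA.
have q_inj : {in A &, injective q}.
  move=> a b aA bA pab; apply: (linkage_inj linkq aA bA (v := a)).
    exact: linkage_head linkq aA.
  by rewrite -pab; apply: linkage_head linkq aA.
have RA i : R i \subset A.
  by have [RS _ _] := cutP i; apply: subset_trans RS (SA i).
have inR i a : a \in A -> (p a \in [fset p b | b in R i]%fset) = (a \in R i).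
  move=> aA; apply/imfsetP/idP => /= [[b bR /p_inj->] //|aR]; last by exists a.
  exact: subsetP (RA i) b bR.
have S_R j a : a \in A -> (a \in S j) = [forall i : 'I_j, a \notin R i].
  move=> aA; elim: j => [|j IHj].
    by rewrite S0 aA; apply/esym/forallP=> -[].
  rewrite SS inE IHj; apply/andP/forallP=> [[aj /forallP ai] i|ai].
    have [ij|] := ltnP i j; first exact: (ai (Ordinal ij)).
    move=> ji; suffices -> : nat_of_ord i = j by [].
    by apply/eqP; rewrite eqn_leq ji -ltnS ltn_ord.
  split; first exact: (ai ord_max).
  by apply/forallP=> i; apply: (ai (widen_ord (leqnSn j) i)).
exists (fun i : 'I_D => [fset p a | a in R i]%fset), [fset s a | a in J]%fset, f.
have P'P x : x \in (P `\` \bigcup_(i in 'I_D) [fset p a | a in R i])%fset <->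
   exists2 a, a \in S D & x = p a.
  rewrite in_fsetD; split=> [/andP[xR /Pp[a aA def_x]]|[a aS ->]].
    exists a => //; rewrite S_R //; apply/forallP=> i.
    apply: contra xR => aR; apply/bigfcupP; exists i; rewrite ?mem_index_enum //.
    by rewrite def_x inR.
  have aA := subsetP (SA D) a aS; rewrite pP // andbT.
  apply/bigfcupP=> -[i _]; rewrite inR // => aR.
  by move: aS; rewrite S_R // => /forallP/(_ i); rewrite aR.
split.
- split=> [i|i j ij|i].
  + apply/fsubsetP=> _ /imfsetP[/= a aR ->].
    exact/pP/(subsetP (RA i)).
  (* The later set lies in [S i'.+1], from which [R i'] has been removed. *)
  + have disjR (i' j' : nat) : i' < j' -> [disjoint R i' & R j'].
      move=> ij'; have [RS _ _] := cutP j'.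
      rewrite disjoint_sym; apply: disjointWl (subset_trans RS (S_mono _ _ ij')) _.
      by rewrite SS -setI_eq0 setIDAC setDIl setDv setI0.
    apply/fdisjointP=> _ /imfsetP[/= a aR ->]; rewrite inR ?(subsetP (RA i)) //.
    have : [disjoint R i & R j].
      case: (ltngtP i j) ij => [/disjR|/disjR|/val_inj->] //; rewrite ?eqxx //.
      by rewrite disjoint_sym.
    by move/disjointFr->.
  + have [_ ltk _] := cutP i; rewrite card_in_imfset /=; last first.
      by move=> a b /(subsetP (RA i)) aA /(subsetP (RA i)); apply: p_inj.
    by rewrite -cardE; lia.
- split.
  + by rewrite card_in_imfset //= -cardE.
  + move=> _ _ /imfsetP[/= a aJ ->] /imfsetP[/= b bJ ->] sab.
    by apply: s_disj; rewrite ?JS //; apply: contra sab => /eqP->.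
  + move=> _ _ /imfsetP[/= a aJ ->] /imfsetP[/= b bJ ->]; rewrite !fE // => qab.
    by rewrite (q_inj a b) ?(subsetP (SA D)) ?JS.
  + move=> _ /imfsetP[/= a aJ ->]; rewrite fE //; have aS := JS a aJ.
    have [qa va sV] := sP a aS; split.
    * apply/imfsetP; exists (p a) => /=; first by apply/P'P; exists a.
      by apply/esym/(companion_indexed linkp linkq) => //; apply: subsetP (SA D) a aS.
    * by rewrite qa -cat_rcons; apply: suffixW; apply: suffix_suffix.
    have [y [z [r sa]]] := sE a aJ; have [sp sX] := s_path a aS.
    have [_ /andP[pq _]] := linkq.1 a (subsetP (SA D) a aS).
    (* On [q a] the first vertex [y] of the tail lies between [v a] and [z], so its degree exceeds
       1. *)
    have yX : y \notin X.
      apply/negP=> /degX deg1; move: pq; rewrite qa sa.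
      by move/(inner_degree e_sym); rewrite deg1.
    by rewrite sa /= in sX *; rewrite (negPf yX) sX.
(* Tails start after the last vertex on the paths of [S D], which are those of [P']. *)
- move=> x _ /P'P[a aS ->] /imfsetP[/= b bJ ->].
  apply/disjoint_seqP=> u ua ub; have [_ _ /hasP[]] := sP b (JS b bJ).
  by exists u => //=; apply/verticesP; exists a.
move=> i; have [_ ltk _] := cutP i.
apply: (@leq_trans #|Y i|); last by lia.
(* Tails missing the paths of [R i] all meet [Y i], and [#|Y i| < k]. *)
pose K := [set a in J | [disjoint vertices p (R i) & s a]].
apply: (@leq_trans #|K|); last first.
  apply: (card_disjoint_hits (s := s)) => [a b|a].
    by rewrite !inE => /andP[/JS aS _] /andP[/JS bS _]; apply: s_disj.
  rewrite inE => /andP[/JS aS /disjointFl sR].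
  have /hasP[u us] := s_hits a i aS (ltn_ord i).
  by rewrite /= inE sR //= => uY; apply/hasP; exists u.
have -> : #|K| = #|` [fset s a | a in K]%fset|.
  rewrite card_in_imfset /= -?cardE // => a b.
  by rewrite !inE => /andP[aJ _] /andP[bJ _]; apply: s_inj.
apply/fsubset_leq_card/fsubsetP=> x; rewrite !inE /= => /andP[].
move=> /imfsetP[/= a aJ ->] /allP sR; apply/imfsetP; exists a => //=.
rewrite inE aJ /=; apply/pred0P=> u; apply/negP=> /andP[/verticesP[b bR ub] us].
apply: (disjoint_seqP _ _ (sR (p b) _) u ub us).
by apply/imfsetP; exists b.
Qed.
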